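(* Let $d\ge1$ and $0\le k\le d$, and let $W=V^{\otimes d}\otimes_{\mathbb C\mathfrak S_d}\mathbb C\mathfrak S_{d+k}\subset\overline T_d(V)$, with $\mathbb C\mathfrak S_{d+k}$ acting on $W$ by right multiplication (identified with its image in $\mathrm{End}_{\mathbb C}(W)$). Let $\mathcal A_d^k\subset\mathrm{End}_{\mathbb C}(W)$ be the linear span of all operators $L(w_d)\cdots L(w_1)L(\sigma)L(v_1^\ast)\cdots L(v_d^\ast)$ (restricted to $W$) with $w_1,\dots,w_d\in V$, $\sigma\in\mathfrak S_{d+k}$, $v_1^\ast,\dots,v_d^\ast\in V^\ast$. Then $$\mathcal A_d^k=\mathrm{End}_{\mathbb C\mathfrak S_{d+k}}(W)\qquad\text{and}\qquad \mathrm{End}_{\mathcal A_d^k}(W)=\mathbb C\mathfrak S_{d+k}.$$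
   Context: Let $m,n\ge 1$ and $V=\mathbb C^{m|n}$ with standard basis $e_1,\dots,e_{m+n}$, where $|e_i|=0$ for $i\le m$ and $|e_i|=1$ for $i>m$; let $e_1^\ast,\dots,e_{m+n}^\ast$ be the dual basis with $|e_i^\ast|=|e_i|$. All vectors are homogeneous. A pure tensor $v_d\otimes\cdots\otimes v_1\in V^{\otimes d}$ is written $v_d\cdots v_1$ (factors indexed decreasingly from left to right). $\mathfrak S_d$ is the symmetric group on $\{1,\dots,d\}$, $s_i=(i\ i+1)$, $\mathfrak S_\infty=\bigcup_d\mathfrak S_d$, and for $k\ge1$ the group homomorphism $\sigma\mapsto\sigma^{\uparrow k}$ of $\mathfrak S_\infty$ is defined by $s_i^{\uparrow k}=s_{i+k}$. The right action of $\mathfrak S_d$ on $V^{\otimes d}$ is $(v_d\cdots v_1).s_i=(-1)^{|v_i||v_{i+1}|}v_d\cdots v_{i+2}v_iv_{i+1}v_{i-1}\cdots v_1$ (the factors in positions $i,i+1$ are swapped). Set $\overline T_d(V)=V^{\otimes d}\otimes_{\mathbb C\mathfrak S_d}\mathbb C\mathfrak S_\infty$ (so $\overline T_0(V)=\mathbb C\mathfrak S_\infty$) and $\overline T(V)=\bigoplus_{d\ge0}\overline T_d(V)$, with the associative product $(u_k\cdots u_1\otimes\tau)\cdot(v_d\cdots v_1\otimes\sigma)=u_k\cdots u_1v_d\cdots v_1\otimes\tau^{\uparrow d}\sigma$. For $\varphi\in\overline T(V)$, $L(\varphi)$ denotes left multiplication by $\varphi$; in particular $L(v)$ for $v\in V$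 (identified with $v\otimes 1\in\overline T_1(V)$) and $L(\sigma)$ for $\sigma\in\mathfrak S_\infty$ (identified with $1\otimes\sigma\in\overline T_0(V)$). For homogeneous $v^\ast\in V^\ast$, $L(v^\ast)$ is the linear map with $L(v^\ast)=0$ on $\overline T_0(V)$ and $$L(v^\ast)(v_d\cdots v_1\otimes\sigma)=\sum_{k=1}^d(-1)^{|v^\ast|(|v_d|+\cdots+|v_{k+1}|)}\langle v^\ast,v_k\rangle\, v_d\cdots\widehat{v_k}\cdots v_1\otimes s_{d-1}s_{d-2}\cdots s_k\,\sigma,$$ where $\widehat{v_k}$ means omission and the product $s_{d-1}\cdots s_k$ is $1$ for $k=d$; $L$ is extended linearly to all of $V^\ast$. For a subset $A$ of $\mathrm{End}_{\mathbb C}(W)$, $\mathrm{End}_A(W)$ denotes its commutant. *)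

(* Defs.v *)
(* Concrete finite-dimensional model of
   W = V^{(x)d} (x)_{C S_d} C S_{d+k}, realised as a quotient of the free space
   U_d = V^{(x)d} (x) C S_{d+k} (basis: pairs (basis word, permutation)) by the
   subspace Rel of the balancing relations.  Linear maps are matrices acting on
   ROW vectors (u *m A *m B = "apply A, then B"). *)
From HB Require Import structures.
From mathcomp Require Import all_boot all_order all_algebra all_fingroup.
From mathcomp Require Import reals complex.

Set Implicit Arguments.
Unset Strict Implicit.
Unset Printing Implicit Defensive.

Import GRing.Theory.
Local Open Scope ring_scope.

Section SuperSchurWeyl.
Variable F : fieldType.
(* V = F^{m|n}; N = d + k is the size of the symmetric group S_{d+k}. *)
Variables (m n N : nat).

(* basis indices of V; e_a is odd iff a >= m (0-indexed) *)
Definition letter := 'I_(m + n).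
Definition par (a : letter) : bool := (m <= a)%N.

(* basis words of V^{(x)j}: position q+1 (1-indexed, as in v_j ... v_1)
   is stored at ordinal q *)
Definition word j := {ffun 'I_j -> letter}.
Definition Ix j := (word j * {perm 'I_N})%type.
Definition dimU j := #|{: Ix j}|.

(* the adjacent transposition exchanging i and i+1 (0-indexed), i.e. s_{i+1} *)
Definition tr0 (M : nat) (i : nat) : {perm 'I_M} :=
  match M as M0 return {perm 'I_M0} with
  | 0 => 1%g
  | M'.+1 => tperm (@inord M' i) (@inord M' i.+1)
  end.

(* matrix of a map given on basis elements: entry (a,b) = coefficient of
   basis element b in the image of basis element a *)
Definition mxF j j' (f : Ix j -> Ix j' -> F) : 'M[F]_(dimU j, dimU j') :=
  \matrix_(a, b) f (enum_val a : Ix j) (enum_val b : Ix j').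

Definition addl j (a : letter) (x : word j) : word j.+1 :=
  [ffun q : 'I_j.+1 => if unlift ord_max q is Some q' then x q' else a].
Definition Lvec_e (a : letter) j : 'M[F]_(dimU j, dimU j.+1) :=
  mxF (fun s t => ((t.1 == addl a s.1) && (t.2 == s.2))%:R).
Definition Lvec (v : 'rV[F]_(m + n)) j : 'M[F]_(dimU j, dimU j.+1) :=
  \sum_(a : letter) v 0 a *: Lvec_e a j.

(* L(e_a^* ) : degree j+1 -> degree j (paper's d = j+1, paper's k = p+1) *)
Definition delw j (x : word j.+1) (p : 'I_j.+1) : word j :=
  [ffun q : 'I_j => x (lift p q)].
(* s_{d-1} s_{d-2} ... s_k  with d = j+1, k = p+1, i.e. s_j ... s_{p+1} *)
Definition cyc (j p : nat) : {perm 'I_N} :=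
  foldr (fun i acc => (tr0 N i * acc)%g) 1%g (rev (iota p (j - p))).
Definition Ldual_e (a : letter) j : 'M[F]_(dimU j.+1, dimU j) :=
  mxF (fun s t =>
    \sum_(p : 'I_j.+1)
      if [&& s.1 p == a, t.1 == delw s.1 p & t.2 == (cyc j p * s.2)%g]
      then (-1) ^+ (par a * \sum_(q : 'I_j.+1 | (p < q)%N) par (s.1 q))
      else 0).
Definition Ldual (vs : 'rV[F]_(m + n)) j : 'M[F]_(dimU j.+1, dimU j) :=
  \sum_(a : letter) vs 0 a *: Ldual_e a j.

(* L(sigma) on degree 0 = C S_{d+k}: rho |-> sigma^{up 0} rho = sigma rho *)
Definition Lperm0 (sigma : {perm 'I_N}) : 'M[F]_(dimU 0, dimU 0) :=
  mxF (fun s t => ((t.1 == s.1) && (t.2 == (sigma * s.2)%g))%:R).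

Fixpoint dualchain (vs : nat -> 'rV[F]_(m + n)) (j : nat) : 'M[F]_(dimU j, dimU 0) :=
  match j with
  | 0 => 1%:M
  | j'.+1 => Ldual (vs j'.+1) j' *m dualchain vs j'
  end.
Fixpoint upchain (ws : nat -> 'rV[F]_(m + n)) (j : nat) : 'M[F]_(dimU 0, dimU j) :=
  match j with
  | 0 => 1%:M
  | j'.+1 => upchain ws j' *m Lvec (ws j'.+1) j'
  end.

(* lift to U_d of  L(w_d)...L(w_1) L(sigma) L(v_1^* )...L(v_d^* )
   (w_i = ws i, v_i^* = vs i for 1 <= i <= d) *)
Definition genA d (ws : nat -> 'rV[F]_(m + n)) (sigma : {perm 'I_N})
    (vs : nat -> 'rV[F]_(m + n)) : 'M[F]_(dimU d) :=
  dualchain vs d *m Lperm0 sigma *m upchain ws d.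

(* balancing relations of (x)_{C S_d}:  (x.s_{i+1}) (x) rho = x (x) s_{i+1} rho,
   0 <= i < d-1, where x.s_{i+1} = (-1)^{|x_i||x_{i+1}|} (x with the factors in
   the two positions swapped) *)
Definition swapw d (x : word d) (i : nat) : word d := [ffun q => x (tr0 d i q)].
Definition swsign d (x : word d) (i : nat) : F :=
  (-1) ^+ [forall q : 'I_d, ((val q == i) || (val q == i.+1)) ==> par (x q)].
Definition Rel d : 'M[F]_(#|{: Ix d * 'I_d.-1}|, dimU d) :=
  \matrix_(r, b)
    (let: ((x, rho), i) := (enum_val r : Ix d * 'I_d.-1) in
     swsign x i * ((enum_val b : Ix d) == (swapw x i, rho))%:R
     - ((enum_val b : Ix d) == (x, (tr0 N i * rho)%g))%:R).

(* operators on W are represented by matrices A on U_d with Rel A <= Rel;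
   A and B represent the same operator iff (A - B <= Rel)%MS *)
Definition preserves d (A : 'M[F]_(dimU d)) : bool := (Rel d *m A <= Rel d)%MS.

Definition Rperm d (pi : {perm 'I_N}) : 'M[F]_(dimU d) :=
  mxF (fun s t => ((t.1 == s.1) && (t.2 == (s.2 * pi)%g))%:R).

Definition inAlg d (A : 'M[F]_(dimU d)) : Prop :=
  exists s : seq (F * ((nat -> 'rV[F]_(m + n)) * {perm 'I_N}
                       * (nat -> 'rV[F]_(m + n)))),
    (A - \sum_(t <- s) t.1 *: genA d t.2.1.1 t.2.1.2 t.2.2 <= Rel d)%MS.

Definition commW d (A B : 'M[F]_(dimU d)) : bool := (A *m B - B *m A <= Rel d)%MS.

End SuperSchurWeyl.

(* Main.v *)
(* Write G for the group algebra of S_N and, for words x, y over the basis of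
   V, write up_x : G -> W for the G-map 1 |-> x (x) 1 and dual_y : W -> G for
   the composite of the operators L(e_a^ * ), a running through y.  Moving a
   letter to the top of a word is, up to sign, an instance of the balancing
   relation, so sum_a L(e_a) L(e_a^ * ) is multiplication by the degree and
   sum_y up_y dual_y = d! on W.  Hence a G-map A on W equals
   1/d! sum_y (A up_y) dual_y, and every G-map G -> W is a combination of the
   maps up_x L(sigma): this is the first equality.  For the second one, let I be
   the left ideal of G spanned by the images of the L(sigma) dual_y; it has a
   right identity e by Maschke, and W = W I, so e acts as the identity on W.
   Writing e = sum_i g_i(w_i), an operator T commuting with all maps f g_i,
   f : G -> W, satisfies T(w) = T(w e) = w (sum_i g_i(T w_i)). *)
Require Import Defs.
From HB Require Import structures.
From mathcomp Require Import all_boot all_order all_algebra all_fingroup.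
From mathcomp Require Import reals complex zify.
Local Open Scope ring_scope.

Set Implicit Arguments.
Unset Strict Implicit.
Unset Printing Implicit Defensive.

Import GRing.Theory.

(** * Adjacent transpositions and cycles *)

Lemma tr0E M i (a b : 'I_M) : val a = i -> val b = i.+1 -> tr0 M i = tperm a b.
Proof.
case: M a b => [|M] a b ai bi /=; first by case: a ai.
by rewrite -bi -ai !inord_val.
Qed.

Lemma val_tr0 M i (q : 'I_M) : (i.+1 < M)%N ->
  val (tr0 M i q) = if q == i :> nat then i.+1 else if q == i.+1 :> nat then i else q.
Proof.
move=> iM; pose a := Ordinal (ltnW iM); pose b := Ordinal iM.
rewrite (@tr0E M i a b) //; case: tpermP => [->|->|/eqP qa /eqP qb] /=.
- by rewrite eqxx.
- by rewrite eqxx; case: ifP => // /eqP; lia.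
- by rewrite -!val_eqE /= in qa qb; rewrite (negbTE qa) (negbTE qb).
Qed.

Lemma tr0K M i : (tr0 M i * tr0 M i = 1)%g.
Proof. by case: M => [|M]; rewrite /= ?mulg1 ?tperm2. Qed.

Lemma tr0_far M i j : (i.+1 < j)%N -> (j.+1 < M)%N ->
  (tr0 M j * tr0 M i = tr0 M i * tr0 M j)%g.
Proof.
move=> ij jM; apply/permP => q; apply: val_inj; rewrite !permM !val_tr0; try lia.
by do ![case: eqP => //=]; lia.
Qed.

Lemma tr0_braid M i : (i.+2 < M)%N ->
  (tr0 M i.+1 * tr0 M i * tr0 M i.+1 = tr0 M i * tr0 M i.+1 * tr0 M i)%g.
Proof.
move=> iM; apply/permP => q; apply: val_inj; rewrite !permM !val_tr0; try lia.
by do ![case: eqP => //=]; lia.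
Qed.

Lemma cycnn N j : cyc N j j = 1%g.
Proof. by rewrite /cyc subnn. Qed.

Lemma cyc_recl N j p : (p < j)%N -> cyc N j p = (cyc N j p.+1 * tr0 N p)%g.
Proof.
move=> pj; rewrite /cyc -[in LHS]subnSK //= rev_cons -cats1 foldr_cat /= mulg1.
by elim: (rev _) => [|i s IHs] /=; rewrite ?mul1g // IHs mulgA.
Qed.

(** Every factor of [cyc N j p] has index at least [p], hence far from [i]. *)
Lemma cyc_tr0_far N j p i : (i.+1 < p <= j)%N -> (j < N)%N ->
  (cyc N j p * tr0 N i = tr0 N i * cyc N j p)%g.
Proof.
move=> /andP[ip pj] jN; move: ip; rewrite -(subKn pj).
elim: (j - p)%N {pj} => [|e IHe] ip; first by rewrite subn0 cycnn mulg1 mul1g.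
have [ej|je] := ltnP e j; last first.
  by move: ip; have -> : (j - e.+1 = 0)%N by lia.
rewrite cyc_recl ?subnSK; [|lia..].
by rewrite -mulgA tr0_far ?mulgA ?IHe //; lia.
Qed.

(** Moving left, [tr0 N i.+1] commutes with the factors of index below [i], turns into [tr0 N i] by
    the braid relation, then commutes with the factors of index above [i.+1]. *)
Lemma cyc_tr0_slide N j p i : (p <= i)%N -> (i.+1 < j)%N -> (j < N)%N ->
  (cyc N j p * tr0 N i.+1 = tr0 N i * cyc N j p)%g.
Proof.
move=> le_pi ij jN; rewrite -(subKn le_pi); elim: (i - p)%N {le_pi} => [|e IHe].
  rewrite subn0 (@cyc_recl N j i) ?(@cyc_recl N j i.+1); [|lia..].
  rewrite -!mulgA (mulgA (tr0 N i.+1)) tr0_braid; last lia.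
  by rewrite !mulgA cyc_tr0_far //; lia.
(* Once [e >= i], truncated subtraction keeps the lower end at 0. *)
have [ei|ie] := ltnP e i; last first.
  by move: IHe; have -> : (i - e.+1 = i - e)%N by lia.
rewrite cyc_recl ?subnSK; [|lia..].
by rewrite -mulgA -tr0_far ?mulgA ?IHe //; lia.
Qed.

(** * Words *)

Section Words.
Variables (m n : nat).
Implicit Type j : nat.
Local Notation word := (word m n).

Lemma swapwE j (x : word j) i q : swapw x i q = x (tr0 j i q).
Proof. by rewrite ffunE. Qed.

Lemma swapwK j (x : word j) i : swapw (swapw x i) i = x.
Proof. by apply/ffunP => q; rewrite !ffunE -permM tr0K perm1. Qed.

Lemma delw_addl j a (x : word j) : delw (addl a x) ord_max = x.
Proof. by apply/ffunP => q; rewrite !ffunE liftK. Qed.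

Lemma addl_max j a (x : word j) : addl a x ord_max = a.
Proof. by rewrite ffunE unlift_none. Qed.

Lemma addl_lift j a (x : word j) q : addl a x (lift ord_max q) = x q.
Proof. by rewrite ffunE liftK. Qed.

Lemma addl_delw j (x : word j.+1) : addl (x ord_max) (delw x ord_max) = x.
Proof. by apply/ffunP => q; rewrite !ffunE; case: unliftP => [r|] ->; rewrite ?ffunE. Qed.

Lemma swapw_addl j a (x : word j) i : (i.+1 < j)%N ->
  swapw (addl a x) i = addl a (swapw x i).
Proof.
move=> ij; apply/ffunP => q; rewrite swapwE.
have [r ->|->] := unliftP ord_max q; last first.
  rewrite (_ : tr0 _ _ _ = ord_max) ?addl_max //; apply: val_inj.
  by rewrite val_tr0 /=; [do ![case: eqP => //=] | ]; lia.
rewrite addl_lift swapwE (_ : tr0 _ _ _ = lift ord_max (tr0 j i r)) ?addl_lift //.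
have bumpE (s : 'I_j) : bump j s = s by rewrite /bump leqNgt ltn_ord.
by apply: val_inj; rewrite val_tr0 /= ?bumpE ?val_tr0 //; lia.
Qed.

(** The swap moves the letter at [p] to [q], so both sides omit the same letter and keep the others
    in order. *)
Lemma delw_swapw_succ j (x : word j.+1) (p q : 'I_j.+1) : val q = p.+1 ->
  delw (swapw x p) q = delw x p.
Proof.
move=> qp; apply/ffunP => r; rewrite !ffunE; congr (x _); apply: val_inj.
have pj : (p.+1 < j.+1)%N by rewrite -qp ltn_ord.
rewrite val_tr0 //= qp /bump.
by case: (leqP p r) => ?; case: (leqP p.+1 r) => ? /=; do ![case: eqP => //=]; lia.
Qed.

Lemma delw_swapw j (x : word j.+1) (p q : 'I_j.+1) : val q = p.+1 ->
  delw (swapw x p) p = delw x q.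
Proof. by move=> qp; rewrite -(delw_swapw_succ _ qp) swapwK. Qed.

Lemma delw_swapw_lt j (x : word j.+1) (p : 'I_j.+1) i : (i.+1 < p)%N ->
  delw (swapw x i) p = swapw (delw x p) i.
Proof.
move=> ip; apply/ffunP => r; rewrite !ffunE; congr (x _); apply: val_inj.
have pj := ltn_ord p; rewrite /= val_tr0 /=; last lia.
rewrite val_tr0 /bump; last lia.
by case: (leqP p r) => ? /=; do ![case: eqP => //=]; lia.
Qed.

Lemma delw_swapw_gt j (x : word j.+1) (p : 'I_j.+1) i :
  (p <= i)%N -> (i.+1 < j)%N ->
  delw (swapw x i.+1) p = swapw (delw x p) i.
Proof.
move=> ip ij; apply/ffunP => r; rewrite !ffunE; congr (x _); apply: val_inj.
have pj := ltn_ord p; rewrite /= val_tr0 /=; last lia.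
rewrite val_tr0 /bump; last lia.
by case: (leqP p r) => ? /=; do ![case: eqP => //=]; lia.
Qed.

End Words.

(** * Operators modulo the balancing relations *)

Section Modules.
Variables (F : fieldType) (m n N : nat).
Local Notation word := (word m n).
Local Notation Ix := (Ix m n N).
Local Notation dimU := (dimU m n N).
Local Notation Rel := (Rel F m n N).
Implicit Types (j r : nat) (a : letter m n).

(** * Evaluation on basis elements *)

Definition ev j (s : Ix j) : 'rV[F]_(dimU j) := delta_mx 0 (enum_rank s).

Lemma ev_mxF j j' (f : Ix j -> Ix j' -> F) s :
  ev s *m mxF f = \sum_t f s t *: ev t.
Proof.
apply/rowP => b; rewrite -rowE !mxE enum_rankK summxE (bigD1 (enum_val b)) //=.
rewrite !mxE enum_valK !eqxx mulr1 big1 ?addr0 // => t tb.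
by rewrite !mxE /= eq_sym (can2_eq enum_valK enum_rankK) eq_sym in tb *; rewrite (negbTE tb) mulr0.
Qed.

Lemma ev_mxF1 j j' (f : Ix j -> Ix j' -> F) s t0 :
  (forall t, f s t = (t == t0)%:R) -> ev s *m mxF f = ev t0.
Proof.
move=> fE; rewrite ev_mxF (bigD1 t0) //= fE eqxx scale1r big1 ?addr0 // => t tt.
by rewrite fE (negbTE tt) scale0r.
Qed.

Lemma eq_ev j r (A B : 'M[F]_(dimU j, r)) :
  (forall s, ev s *m A = ev s *m B) -> A = B.
Proof.
by move=> AB; apply/row_matrixP => i; rewrite !rowE -(enum_valK i) [LHS]AB.
Qed.

Lemma sub_ev j r r' (A : 'M[F]_(dimU j, r)) (X : 'M[F]_(r', r)) :
  (forall s, (ev s *m A <= X)%MS) -> (A <= X)%MS.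
Proof. by move=> AX; apply/row_subP => i; rewrite rowE -(enum_valK i); apply: AX. Qed.

Lemma row_ev j (u : 'rV[F]_(dimU j)) : u = \sum_s u 0 (enum_rank s) *: ev s.
Proof.
rewrite [LHS]row_sum_delta (reindex (@enum_rank _)) //.
by apply: onW_bij; apply: enum_rank_bij.
Qed.

Lemma ev_Lvec_e j a x rho : ev (x, rho) *m Lvec_e F N a j = ev (addl a x, rho).
Proof. by apply: ev_mxF1 => -[y sigma]. Qed.

Lemma ev_Lperm0 sigma x rho : ev (x, rho) *m Lperm0 F m n sigma = ev (x, (sigma * rho)%g).
Proof. by apply: ev_mxF1 => -[y tau]. Qed.

Lemma ev_Rperm j tau x rho : ev (x, rho) *m Rperm F m n j tau = ev (x, (rho * tau)%g).
Proof. by apply: ev_mxF1 => -[y sigma]. Qed.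

(* The sign of the term of L(v^ * ) that deletes position [p]. *)
Definition sgdel j (x : word j.+1) (p : 'I_j.+1) : F :=
  (-1) ^+ (par (x p) * \sum_(q : 'I_j.+1 | (p < q)%N) par (x q)).

Lemma ev_Ldual_e j a x rho : ev (x, rho) *m Ldual_e F N a j =
  \sum_(p | x p == a) sgdel x p *: ev (delw x p, (cyc N j p * rho)%g).
Proof.
rewrite ev_mxF [RHS]big_mkcond /=.
under eq_bigr do rewrite scaler_suml.
rewrite exchange_big; apply: eq_bigr => p _ /=.
have [<-|_] := eqVneq (x p) a; last by rewrite big1 // => t _; rewrite scale0r.
rewrite (bigD1 (delw x p, (cyc N j p * rho)%g)) //= !eqxx [X in _ + X]big1 ?addr0 // => -[y tau] /=.
by rewrite xpair_eqE => /negbTE ->; rewrite scale0r.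
Qed.

(** * Signs under an adjacent swap *)

Lemma swsignE j (x : word j) (a b : 'I_j) : val b = a.+1 ->
  swsign F x a = (-1) ^+ (par (x a) && par (x b)).
Proof.
move=> ba; rewrite /swsign; congr (_ ^+ nat_of_bool _).
apply/forallP/andP => [H|[Ha Hb] q].
  by move: (H a) (H b); rewrite /= eqxx -ba eqxx orbT.
by apply/implyP => /orP[/eqP qa|/eqP qb]; [rewrite (val_inj qa)|
  have -> : q = b by apply: val_inj; rewrite ba].
Qed.

Lemma swsignK j (x : word j) i : swsign F x i * swsign F x i = 1.
Proof. by rewrite /swsign -expr2 sqrr_sign. Qed.

Lemma swsign_swapw j (x : word j) i : (i.+1 < j)%N ->
  swsign F (swapw x i) i = swsign F x i.
Proof.
move=> ij; pose a := Ordinal (ltnW ij); pose b := Ordinal ij.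
rewrite !(@swsignE _ _ a b) // !swapwE (@tr0E _ _ a b) // tpermL tpermR.
by rewrite andbC.
Qed.

(** After the swap the deleted letter no longer has to pass [x q]; the missing factor is the sign of
    the swap. *)
Lemma sgdel_swapw_succ j (x : word j.+1) (p q : 'I_j.+1) : val q = p.+1 ->
  swsign F x p * sgdel (swapw x p) q = sgdel x p.
Proof.
move=> qp; rewrite (swsignE _ qp) /sgdel !swapwE (tr0E (erefl (val p)) qp) tpermR.
rewrite [in RHS](bigD1 q) /=; last by rewrite -[nat_of_ord q]/(val q) qp.
rewrite -exprD mulnDr mulnb; congr (_ ^+ (_ + _ * _)).
apply: eq_big => [r|r qr].
  by rewrite -val_eqE /=; move: qp => /= ->; case: ltngtP; lia.
have qr' : (p.+1 < r)%N by rewrite -qp.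
by rewrite swapwE (tr0E (erefl (val p)) qp) tpermD // -val_eqE /=; move: qp => /= qp; lia.
Qed.

Lemma sgdel_swapw j (x : word j.+1) (p q : 'I_j.+1) : val q = p.+1 ->
  swsign F x p * sgdel (swapw x p) p = sgdel x q.
Proof.
move=> qp; have pj : (p.+1 < j.+1)%N by rewrite -qp ltn_ord.
rewrite -(sgdel_swapw_succ (swapw x p) qp) swapwK swsign_swapw //.
by rewrite mulrA swsignK mul1r.
Qed.

(** The letters above [p] are only permuted, so their total parity does not change. *)
Lemma sgdel_swapw_far j (x : word j.+1) (p : 'I_j.+1) i :
  (i.+1 < j.+1)%N -> val p <> i -> val p <> i.+1 ->
  sgdel (swapw x i) p = sgdel x p.
Proof.
move=> ij pi pi1; rewrite /sgdel swapwE (_ : tr0 _ _ p = p); last first.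
  by apply: val_inj; rewrite val_tr0 //; do 2![case: eqP => //].
congr (_ ^+ (_ * _)); rewrite (reindex_inj (@perm_inj _ (tr0 j.+1 i))) /=.
apply: eq_big => [q|q _]; last by rewrite swapwE -permM tr0K perm1.
by move: pi pi1; rewrite /= val_tr0 //; do ![case: eqP => //=]; lia.
Qed.


(* Equality modulo [Rel], i.e. equality of maps into W. *)
Definition eqR j r (A B : 'M[F]_(r, dimU j)) := (A - B <= Rel j)%MS.

Lemma eqR_refl j r (A : 'M[F]_(r, dimU j)) : eqR A A.
Proof. by rewrite /eqR subrr sub0mx. Qed.

Lemma eqR_sym j r (A B : 'M[F]_(r, dimU j)) : eqR A B -> eqR B A.
Proof. by rewrite /eqR -opprB eqmx_opp. Qed.

Lemma eqRD j r (A B A' B' : 'M[F]_(r, dimU j)) :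
  eqR A A' -> eqR B B' -> eqR (A + B) (A' + B').
Proof. by move=> AA BB; rewrite /eqR opprD addrACA addmx_sub. Qed.

Lemma eqR_trans j r (B A C : 'M[F]_(r, dimU j)) : eqR A B -> eqR B C -> eqR A C.
Proof. by move=> AB BC; rewrite /eqR -[A](subrK B) -addrA addmx_sub. Qed.

Lemma eqR_sum j r (I : Type) (s : seq I) (P : pred I) (A B : I -> 'M[F]_(r, dimU j)) :
  (forall i, P i -> eqR (A i) (B i)) -> eqR (\sum_(i <- s | P i) A i) (\sum_(i <- s | P i) B i).
Proof. by move=> AB; rewrite /eqR -sumrB summx_sub. Qed.

Lemma eqRMl j r r' (C : 'M[F]_(r', r)) (A B : 'M[F]_(r, dimU j)) :
  eqR A B -> eqR (C *m A) (C *m B).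
Proof. by move=> AB; rewrite /eqR -mulmxBr (submx_trans (submxMl _ _)). Qed.

(** Matrices act from the right, so a right factor must respect the relations, while a left factor
    may be arbitrary. *)
Lemma eqRMr j j' r (M : 'M[F]_(dimU j, dimU j')) (A B : 'M[F]_(r, dimU j)) :
  (Rel j *m M <= Rel j')%MS -> eqR A B -> eqR (A *m M) (B *m M).
Proof. by move=> RM AB; rewrite /eqR -mulmxBl (submx_trans (submxMr _ AB)). Qed.

Lemma eqRZ j r c (A B : 'M[F]_(r, dimU j)) : eqR A B -> eqR (c *: A) (c *: B).
Proof. by move=> AB; rewrite /eqR -scalerBr scalemx_sub. Qed.

Lemma eqR_ev j j' (A B : 'M[F]_(dimU j, dimU j')) :
  (forall s, eqR (ev s *m A) (ev s *m B)) -> eqR A B.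
Proof. by move=> AB; apply: sub_ev => s; rewrite mulmxBr; apply: AB. Qed.

(** * Compatibility of the operators with the relations *)

Lemma row_Rel j x rho (i : 'I_j.-1) : row (enum_rank (x, rho, i)) (Rel j) =
  swsign F x i *: ev (swapw x i, rho) - ev (x, (tr0 N i * rho)%g).
Proof.
apply/rowP => b; rewrite !mxE enum_rankK /=.
by rewrite !(can2_eq (@enum_valK _) (@enum_rankK _)).
Qed.

Lemma eqR_swap j (x : word j) rho i : (i.+1 < j)%N ->
  eqR (swsign F x i *: ev (swapw x i, rho)) (ev (x, (tr0 N i * rho)%g)).
Proof.
case: j x => [|j] x // ij; rewrite /eqR.
by rewrite -[(i)]/(val (Ordinal (ij : (i < j.+1.-1)%N))) -row_Rel row_sub.
Qed.

Lemma RelM_sub j r r' (M : 'M[F]_(dimU j, r)) (X : 'M[F]_(r', r)) :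
  (forall x rho i, (i.+1 < j)%N ->
     (swsign F x i *: (ev (swapw x i, rho) *m M)
      - ev (x, (tr0 N i * rho)%g) *m M <= X)%MS) ->
  (Rel j *m M <= X)%MS.
Proof.
move=> MX; apply/row_subP => t; rewrite -(enum_valK t).
case: (enum_val t) => -[x rho] i; rewrite row_mul row_Rel mulmxBl -scalemxAl.
by apply: MX; have := ltn_ord i; lia.
Qed.

(** The index type of the relations is empty: in degree 0 the quotient is the group algebra
    itself. *)
Lemma Rel0_eq0 : Rel 0 = 0.
Proof.
by apply/row_matrixP => t; case: (enum_val t) => _ [].
Qed.

Lemma Rel_Lvec_e a j : (Rel j *m Lvec_e F N a j <= Rel j.+1)%MS.
Proof.
apply: RelM_sub => x rho i ij; rewrite !ev_Lvec_e -swapw_addl //.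
have -> : swsign F x i = swsign F (addl a x) i; last by apply: eqR_swap; lia.
pose p := Ordinal (ltnW ij); pose q := Ordinal ij.
rewrite (@swsignE _ x p q) //.
rewrite (_ : i = lift ord_max p :> nat); last by rewrite lift_max.
by rewrite (@swsignE _ _ _ (lift ord_max q)) ?addl_lift // lift_max [LHS]lift_max.
Qed.

Lemma Rel_Rperm tau j : (Rel j *m Rperm F m n j tau <= Rel j)%MS.
Proof.
by apply: RelM_sub => x rho i ij; rewrite !ev_Rperm -mulgA; apply: eqR_swap.
Qed.

Lemma swsign_delw_lt j (x : word j.+1) (p : 'I_j.+1) i : (i.+1 < p)%N ->
  swsign F (delw x p) i = swsign F x i.
Proof.
move=> ip; have pj := ltn_ord p; have ij : (i.+1 < j)%N by lia.
pose a := Ordinal (ltnW ij); pose b := Ordinal ij.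
rewrite (@swsignE _ _ a b) // !ffunE -(@swsignE _ x (lift p a) (lift p b)) /=.
all: have -> : bump p i = i by rewrite /bump; case: leqP; lia.
  by [].
by rewrite /bump; case: leqP; lia.
Qed.

Lemma swsign_delw_gt j (x : word j.+1) (p : 'I_j.+1) i : (p <= i)%N -> (i.+1 < j)%N ->
  swsign F (delw x p) i = swsign F x i.+1.
Proof.
move=> ip ij; pose a := Ordinal (ltnW ij); pose b := Ordinal ij.
rewrite (@swsignE _ _ a b) // !ffunE -(@swsignE _ x (lift p a) (lift p b)) /=.
all: have -> : bump p i = i.+1 by rewrite /bump ip.
  by [].
by rewrite /bump; case: leqP; lia.
Qed.

(** Both sides of a relation expand into sums over the deleted position, which are compared term by
    term. *)
Lemma Rel_Ldual_e a j : (j < N)%N -> (Rel j.+1 *m Ldual_e F N a j <= Rel j)%MS.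
Proof.
move=> jN; apply: RelM_sub => x rho i ij; rewrite !ev_Ldual_e.
(* Position [p] of [x] is paired with position [tr0 j.+1 i p] of the swapped word, which holds the
   same letter. *)
rewrite (reindex_inj (@perm_inj _ (tr0 j.+1 i))) /= scaler_sumr.
rewrite [X in X - _](eq_bigl (fun p => x p == a)) => [|p]; last first.
  by rewrite swapwE -permM tr0K perm1.
apply: eqR_sum => p /eqP xp; rewrite scalerA mulgA.
(* If the deleted letter is one of the two swapped ones, the terms agree exactly: [cyc_recl] absorbs
   the transposition. *)
have [pi|pi] := eqVneq (val p) i.
  subst i; pose q := Ordinal ij.
  rewrite (_ : tr0 _ _ _ = q); last by apply: val_inj; rewrite val_tr0 // eqxx.
  rewrite sgdel_swapw_succ // delw_swapw_succ // [in X in eqR _ X]cyc_recl //.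
  by rewrite -(mulgA _ _ (tr0 N p)) tr0K mulg1; apply: eqR_refl.
have [pi1|pi1] := eqVneq (val p) i.+1.
  pose q := Ordinal (ltnW ij).
  rewrite (_ : tr0 _ _ _ = q); last first.
    by apply: val_inj; rewrite val_tr0 // pi1 eqxx; case: eqP => //; lia.
  rewrite -[(i)]/(val q) (@sgdel_swapw _ x q p) // (@delw_swapw _ _ _ x q p) // (@cyc_recl _ _ q) //.
  by move: pi1 => /= ->; apply: eqR_refl.
(* Otherwise the swap survives the deletion and gives a relation in degree [j], once its
   transposition has moved through the cycle. *)
rewrite (_ : tr0 _ _ p = p); last first.
  by apply: val_inj; rewrite val_tr0 // (negbTE pi) (negbTE pi1).
rewrite sgdel_swapw_far; [|by []|exact/eqP|exact/eqP].
rewrite mulrC -scalerA; apply: eqRZ.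
have pj := ltn_ord p; have [ip|pi'] := ltnP i.+1 p.
  rewrite delw_swapw_lt // -(swsign_delw_lt _ ip) cyc_tr0_far ?ip // -mulgA.
  by apply: eqR_swap; lia.
case: i ij pi pi1 pi' => [|i] ij pi pi1 pi'; first by move: pi pi1 => /=; lia.
have ip : (p <= i)%N by move: pi pi1 => /=; lia.
rewrite delw_swapw_gt // -(swsign_delw_gt _ ip) // cyc_tr0_slide // -mulgA.
exact: eqR_swap.
Qed.

(** * Deleting letters and putting them back *)

(** Induction on the number of positions above [p]: a swap raises the letter by one, the induction
    hypothesis applies to the swapped word with [tr0 N p * rho], and the relation then cancels the
    transposition. *)
Lemma eqR_move_letter j (x : word j.+1) rho (p : 'I_j.+1) :
  eqR (sgdel x p *: ev (addl (x p) (delw x p), (cyc N j p * rho)%g)) (ev (x, rho)).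
Proof.
have [e] := ubnP (j - p); elim: e x rho p => // e IHe x rho p pe.
have [pj|jp] := ltnP p j; last first.
  have -> : p = ord_max by apply: val_inj => /=; have := ltn_ord p; lia.
  rewrite cycnn mul1g addl_delw /sgdel big1 ?muln0 ?scale1r; first exact: eqR_refl.
  by move=> q; have := ltn_ord q; rewrite /=; lia.
pose q := Ordinal (pj : (p.+1 < j.+1)%N).
rewrite -(@sgdel_swapw_succ _ x p q) // -scalerA cyc_recl // -mulgA.
rewrite -(@delw_swapw_succ _ _ _ x p q) //.
have -> : x p = swapw x p q by rewrite swapwE (@tr0E _ _ p q) // tpermR.
apply: eqR_trans (eqRZ _ (IHe _ _ q _)) _; first by rewrite /=; lia.
apply: eqR_trans (eqR_swap _ _ _) _; first by [].
by rewrite mulgA tr0K mul1g; apply: eqR_refl.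
Qed.

(** Each of the [j.+1] positions [p] contributes only for [a = x p], and its term puts the deleted
    letter back on top, giving the original basis element modulo relations. *)
Lemma eqR_dual_up_e j :
  eqR (\sum_a Ldual_e F N a j *m Lvec_e F N a j) (j.+1%:R)%:M.
Proof.
apply: eqR_ev => -[x rho]; rewrite mulmx_sumr mul_mx_scalar.
under eq_bigr do rewrite mulmxA ev_Ldual_e mulmx_suml big_mkcond.
rewrite exchange_big /=.
rewrite -[X in X%:R](card_ord j.+1) -sum1_card natr_sum scaler_suml.
apply: eqR_sum => p _; rewrite -big_mkcond (big_pred1 (x p)) => [|a]; last by rewrite eq_sym.
by rewrite scale1r -scalemxAl ev_Lvec_e; apply: eqR_move_letter.
Qed.

(* Indexed from 1, as the sequences fed to [upchain] and [dualchain] are. *)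
Definition wordvec j (x : word j) (i : nat) : 'rV[F]_(m + n) :=
  \row_b [exists q : 'I_j, (q.+1 == i) && (x q == b)]%:R.

Lemma wordvecE j (x : word j) (q : 'I_j) : wordvec x q.+1 = delta_mx 0 (x q).
Proof.
apply/rowP => b; rewrite !mxE eqxx /=; congr (nat_of_bool _)%:R.
apply/existsP/eqP => [[r /andP[/eqP[rq] /eqP <-]]|->]; last by exists q; rewrite !eqxx.
by congr (x _); apply: val_inj.
Qed.

Lemma Lvec_delta a j : Lvec N (delta_mx 0 a) j = Lvec_e F N a j.
Proof.
rewrite /Lvec (bigD1 a) //= mxE !eqxx scale1r big1 ?addr0 // => b ba.
by rewrite mxE (negbTE ba) scale0r.
Qed.

Lemma Ldual_delta a j : Ldual N (delta_mx 0 a) j = Ldual_e F N a j.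
Proof.
rewrite /Ldual (bigD1 a) //= mxE !eqxx scale1r big1 ?addr0 // => b ba.
by rewrite mxE (negbTE ba) scale0r.
Qed.

Lemma eq_upchain (ws ws' : nat -> 'rV[F]_(m + n)) j :
  (forall i, (i < j)%N -> ws i.+1 = ws' i.+1) -> upchain N ws j = upchain N ws' j.
Proof.
elim: j => //= j IHj ww; rewrite IHj ?ww // => i ij.
by apply: ww; apply: ltnW.
Qed.

Lemma eq_dualchain (vs vs' : nat -> 'rV[F]_(m + n)) j :
  (forall i, (i < j)%N -> vs i.+1 = vs' i.+1) ->
  dualchain N vs j = dualchain N vs' j.
Proof.
elim: j => //= j IHj vv; rewrite IHj ?vv // => i ij.
by apply: vv; apply: ltnW.
Qed.

Lemma wordvec_addl j a (x : word j) i : (i < j)%N ->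
  wordvec (addl a x) i.+1 = wordvec x i.+1.
Proof.
move=> ij; rewrite -[(i)]/(val (Ordinal ij)) wordvecE -(addl_lift a) -wordvecE.
by congr (wordvec _ _.+1); rewrite lift_max.
Qed.

Lemma upchain_addl j a (x : word j) :
  upchain N (wordvec (addl a x)) j.+1
  = upchain N (wordvec x) j *m Lvec_e F N a j.
Proof.
rewrite /= (wordvecE (addl a x) ord_max) addl_max Lvec_delta.
by rewrite (eq_upchain (ws' := wordvec x)) // => i; apply: wordvec_addl.
Qed.

Lemma dualchain_addl j a (x : word j) :
  dualchain N (wordvec (addl a x)) j.+1
  = Ldual_e F N a j *m dualchain N (wordvec x) j.
Proof.
rewrite /= (wordvecE (addl a x) ord_max) addl_max Ldual_delta.
by rewrite (eq_dualchain (vs' := wordvec x)) // => i; apply: wordvec_addl.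
Qed.

Lemma word0_eq (x y : word 0) : x = y.
Proof. by apply/ffunP => -[]. Qed.

(** Identifies [upchain] of a basis word with the G-map up_x. *)
Lemma ev_upchain j (x : word j) (x0 : word 0) rho :
  ev (x0, rho) *m upchain N (wordvec x) j = ev (x, rho).
Proof.
elim: j x => [|j IHj] x; first by rewrite mulmx1 (word0_eq x0 x).
by rewrite -(addl_delw x) upchain_addl mulmxA IHj ev_Lvec_e.
Qed.

Lemma sum_addl (V : nmodType) j (f : word j.+1 -> V) :
  \sum_x f x = \sum_a \sum_(x : word j) f (addl a x).
Proof.
rewrite pair_big /= (reindex (fun t : letter m n * word j => addl t.1 t.2)) //=.
exists (fun x : word j.+1 => (x ord_max, delw x ord_max)) => [[a x] _|x _] /=.
  by rewrite addl_max delw_addl.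
exact: addl_delw.
Qed.

(** The inner sum over shorter words is j! by induction; the outer sum over top letters supplies the
    factor [j.+1]. *)
Lemma eqR_dual_up j : (j <= N)%N ->
  eqR (\sum_(y : word j) dualchain N (wordvec y) j *m upchain N (wordvec y) j)
      (j`!%:R)%:M.
Proof.
elim: j => [|j IHj] jN.
  rewrite /= sumr_const mulmx1 card_ffun [#|'I_0|]card_ord expn0 mulr1n.
  exact: eqR_refl.
rewrite sum_addl.
under eq_bigr => a _ do under eq_bigr => x _ do
  rewrite dualchain_addl upchain_addl mulmxA -(mulmxA (Ldual_e _ _ _ _)).
under eq_bigr => a _ do rewrite -mulmx_suml -mulmx_sumr.
apply: (@eqR_trans _ _ (\sum_a Ldual_e F N a j *m (j`!%:R)%:M *m Lvec_e F N a j)).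
  apply: eqR_sum => a _; apply: eqRMr; first exact: Rel_Lvec_e.
  by apply: eqRMl; apply: IHj; apply: ltnW.
under eq_bigr do rewrite mul_mx_scalar -scalemxAl.
rewrite -scaler_sumr factS mulnC natrM -scale_scalar_mx.
by apply: eqRZ; apply: eqR_dual_up_e.
Qed.

(** * Generators on W and their equivariance *)

(** The chain ends in degree 0, where there are no relations, so respecting them means killing
    them. *)
Lemma Rel_dualchain vs j : (j <= N)%N -> Rel j *m dualchain N vs j = 0.
Proof.
elim: j => [|j IHj] jN /=; first by rewrite Rel0_eq0 mul0mx.
have /submxP[C RC] : (Rel j.+1 *m Ldual N (vs j.+1) j <= Rel j)%MS.
  rewrite mulmx_sumr summx_sub // => a _.
  by rewrite -scalemxAr scalemx_sub // Rel_Ldual_e.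
by rewrite mulmxA RC -mulmxA IHj ?mulmx0 // ltnW.
Qed.

Lemma preserves_genA d ws (sigma : {perm 'I_N}) vs : (d <= N)%N ->
  @preserves F m n N d (genA d ws sigma vs).
Proof.
by move=> dN; rewrite /preserves /genA !mulmxA Rel_dualchain // !mul0mx sub0mx.
Qed.

Lemma Rperm_Lvec (tau : {perm 'I_N}) v j :
  Rperm F m n j tau *m Lvec N v j = Lvec N v j *m Rperm F m n j.+1 tau.
Proof.
rewrite mulmx_sumr mulmx_suml; apply: eq_bigr => a _.
rewrite -scalemxAr -scalemxAl; congr (_ *: _); apply: eq_ev => -[x rho].
by rewrite !mulmxA ev_Rperm !ev_Lvec_e ev_Rperm.
Qed.

Lemma Rperm_Ldual (tau : {perm 'I_N}) v j :
  Rperm F m n j.+1 tau *m Ldual N v j = Ldual N v j *m Rperm F m n j tau.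
Proof.
rewrite mulmx_sumr mulmx_suml; apply: eq_bigr => a _.
rewrite -scalemxAr -scalemxAl; congr (_ *: _); apply: eq_ev => -[x rho].
rewrite !mulmxA ev_Rperm !ev_Ldual_e mulmx_suml; apply: eq_bigr => p _.
by rewrite -scalemxAl ev_Rperm mulgA.
Qed.

Lemma Rperm_Lperm0 (tau sigma : {perm 'I_N}) :
  Rperm F m n 0 tau *m Lperm0 F m n sigma = Lperm0 F m n sigma *m Rperm F m n 0 tau.
Proof. by apply: eq_ev => -[x rho]; rewrite !mulmxA ev_Rperm !ev_Lperm0 ev_Rperm mulgA. Qed.

Lemma Rperm_upchain (tau : {perm 'I_N}) ws j :
  Rperm F m n 0 tau *m upchain N ws j = upchain N ws j *m Rperm F m n j tau.
Proof.
elim: j => [|j IHj] /=; first by rewrite mul1mx mulmx1.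
by rewrite mulmxA IHj -!mulmxA Rperm_Lvec.
Qed.

Lemma Rperm_dualchain (tau : {perm 'I_N}) vs j :
  Rperm F m n j tau *m dualchain N vs j = dualchain N vs j *m Rperm F m n 0 tau.
Proof.
elim: j => [|j IHj] /=; first by rewrite mul1mx mulmx1.
by rewrite mulmxA Rperm_Ldual -!mulmxA IHj.
Qed.

Lemma Rperm_genA d ws (tau sigma : {perm 'I_N}) vs :
  Rperm F m n d tau *m genA d ws sigma vs = genA d ws sigma vs *m Rperm F m n d tau.
Proof.
rewrite /genA !mulmxA Rperm_dualchain -(mulmxA _ (Rperm _ _ _ _ _)) Rperm_Lperm0.
by rewrite -!mulmxA Rperm_upchain.
Qed.

(** * The two commutants *)

Lemma inAlg_eqR d (A B : 'M[F]_(dimU d)) : eqR A B -> inAlg B -> inAlg A.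
Proof. by move=> AB [s sB]; exists s; apply: eqR_trans AB sB. Qed.

Lemma inAlg_genA d ws (sigma : {perm 'I_N}) vs :
  @inAlg F m n N d (genA d ws sigma vs).
Proof. by exists [:: (1, (ws, sigma, vs))]; rewrite big_seq1 scale1r; apply: eqR_refl. Qed.

Lemma inAlgZ d c (A : 'M[F]_(dimU d)) : inAlg A -> inAlg (c *: A).
Proof.
move=> [s sA]; exists [seq (c * t.1, t.2) | t <- s]; rewrite big_map /=.
by under eq_bigr do rewrite -scalerA; rewrite -scaler_sumr; apply: eqRZ.
Qed.

Lemma inAlg_sum d (I : Type) (r : seq I) (A : I -> 'M[F]_(dimU d)) :
  (forall i, inAlg (A i)) -> inAlg (\sum_(i <- r) A i).
Proof.
move=> AA; elim: r => [|i r [s sr]].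
  by exists [::]; rewrite !big_nil; apply: eqR_refl.
have [si sA] := AA i; exists (si ++ s); rewrite big_cons big_cat /=.
exact: eqRD.
Qed.

Lemma inAlg_commW d (A : 'M[F]_(dimU d)) (tau : {perm 'I_N}) :
  inAlg A -> commW A (Rperm F m n d tau).
Proof.
move=> [s sA]; set S := \sum_(t <- s) _ in sA.
have SR : S *m Rperm F m n d tau = Rperm F m n d tau *m S.
  rewrite mulmx_suml mulmx_sumr; apply: eq_bigr => t _.
  by rewrite -scalemxAl -scalemxAr Rperm_genA.
apply: eqR_trans (eqRMr (Rel_Rperm _ _) sA) _.
by rewrite SR; apply: eqRMl; apply: eqR_sym.
Qed.

(** The composite is equivariant modulo relations, so its value at 1 determines it; the coefficients
    are those of [A] at [y] tensor 1. *)
Lemma eqR_upchainM d (A : 'M[F]_(dimU d)) (y : word d) :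
  (forall tau, commW A (Rperm F m n d tau)) ->
  eqR (upchain N (wordvec y) d *m A)
      (\sum_(s : Ix d) (ev (y, 1%g) *m A) 0 (enum_rank s)
          *: (Lperm0 F m n s.2 *m upchain N (wordvec s.1) d)).
Proof.
move=> AR; apply: eqR_ev => -[x0 rho]; rewrite mulmxA ev_upchain mulmx_sumr.
rewrite -[X in ev (y, X)](mul1g rho) -ev_Rperm -mulmxA.
apply: eqR_trans (eqRMl _ (eqR_sym (AR rho))) _.
rewrite mulmxA {1}[ev _ *m A]row_ev mulmx_suml; apply: eqR_sum => -[x sigma] _.
by rewrite -scalemxAl -scalemxAr ev_Rperm mulmxA ev_Lperm0 ev_upchain; apply: eqR_refl.
Qed.

Lemma commW_inAlg d (A : 'M[F]_(dimU d)) : (d <= N)%N -> d`!%:R != 0 :> F ->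
  preserves A -> (forall tau, commW A (Rperm F m n d tau)) -> inAlg A.
Proof.
move=> dN d0 pA AR.
pose c y s := (ev (y, 1%g : {perm 'I_N}) *m A) 0 (enum_rank s).
apply: (@inAlg_eqR _ _ (d`!%:R^-1 *: \sum_(y : word d) \sum_(s : Ix d)
   c y s *: genA d (wordvec s.1) s.2 (wordvec y))); last first.
  apply: inAlgZ; apply: inAlg_sum => y; apply: inAlg_sum => s.
  exact/inAlgZ/inAlg_genA.
(* Writing [A] as d!^-1 d! [A] lets the scalar d! be replaced by the sum over [y] of dual_y followed
   by up_y. *)
rewrite -[A in eqR A](scalerK d0) -[X in _ *: X]mul_scalar_mx; apply: eqRZ.
apply: eqR_trans (eqRMr pA (eqR_sym (eqR_dual_up dN))) _.
rewrite mulmx_suml; apply: eqR_sum => y _; rewrite -mulmxA.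
apply: eqR_trans (eqRMl _ (eqR_upchainM y AR)) _.
rewrite mulmx_sumr; apply: eqR_sum => s _.
by rewrite -scalemxAr mulmxA; apply: eqR_refl.
Qed.

(** * Left ideals of the group algebra and the second commutant *)

Lemma Lperm0M (g h : {perm 'I_N}) :
  Lperm0 F m n g *m Lperm0 F m n h = Lperm0 F m n (h * g)%g.
Proof. by apply: eq_ev => -[x rho]; rewrite mulmxA !ev_Lperm0 mulgA. Qed.

Lemma Lperm0_1 : Lperm0 F m n (1%g : {perm 'I_N}) = 1%:M.
Proof. by apply: eq_ev => -[x rho]; rewrite ev_Lperm0 mul1g mulmx1. Qed.

(* Right multiplication by the element [u] of the group algebra. *)
Definition Rsum j (u : 'rV[F]_(dimU 0)) : 'M[F]_(dimU j) :=
  \sum_(s : Ix 0) u 0 (enum_rank s) *: Rperm F m n j s.2.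

(** Right multiplication by [u] is rewritten as maps applied to [u] itself, so that an expansion of
    [u] can be substituted. *)
Lemma ev_Rsum j u (x : word j) rho :
  ev (x, rho) *m Rsum j u = u *m Lperm0 F m n rho *m upchain N (wordvec x) j.
Proof.
rewrite [u in RHS]row_ev !mulmx_suml mulmx_sumr; apply: eq_bigr => -[x0 tau] _.
by rewrite -scalemxAr -!scalemxAl ev_Rperm ev_Lperm0 ev_upchain.
Qed.

Lemma Rsum_upchain j u ws : Rsum 0 u *m upchain N ws j = upchain N ws j *m Rsum j u.
Proof.
rewrite mulmx_suml mulmx_sumr; apply: eq_bigr => s _.
by rewrite -scalemxAl -scalemxAr Rperm_upchain.
Qed.

Lemma Rel_Rsum j u : (Rel j *m Rsum j u <= Rel j)%MS.
Proof.
by rewrite mulmx_sumr summx_sub // => s _; rewrite -scalemxAr scalemx_sub // Rel_Rperm.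
Qed.

Lemma Rsum_perm j u (x0 : word 0) :
  Rsum j u = \sum_(tau : {perm 'I_N}) u 0 (enum_rank (x0, tau)) *: Rperm F m n j tau.
Proof.
rewrite /Rsum (reindex (fun tau => (x0, tau))) //=.
by exists (fun s : Ix 0 => s.2) => [tau|[x tau]] _ //=; rewrite (word0_eq x0 x).
Qed.

(* A left ideal of a semisimple group algebra has a right identity: the value
   at [1] of an averaged, hence equivariant, projection onto the ideal. *)
Lemma left_ideal_right_identity r (X : 'M[F]_(r, dimU 0)) :
  N`!%:R != 0 :> F ->
  (forall g, (X *m Lperm0 F m n g <= X)%MS) ->
  exists2 e : 'rV[F]_(dimU 0), (e <= X)%MS &
    forall q (u : 'M[F]_(q, dimU 0)), (u <= X)%MS -> u *m Rsum 0 e = u.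
Proof.
move=> N0 Xstab; pose L := @Lperm0 F m n N.
have [P PX uP] : exists2 P, (P <= X)%MS &
    forall q (u : 'M_(q, _)), (u <= X)%MS -> u *m P = u.
  exists (pinvmx X *m X) => [|q u uX]; first exact: submxMl.
  by rewrite mulmxA mulmxKpV.
pose phi := N`!%:R^-1 *: \sum_h L h *m P *m L h^-1%g.
have phiL g : L g *m phi = phi *m L g.
  rewrite -scalemxAr -scalemxAl mulmx_sumr mulmx_suml; congr (_ *: _).
  rewrite [RHS](reindex_inj (mulIg g)); apply: eq_bigr => h _.
  by rewrite !mulmxA Lperm0M -!mulmxA Lperm0M invMg mulKVg.
have phiX : (phi <= X)%MS.
  rewrite scalemx_sub // summx_sub // => h _; rewrite -mulmxA.
  rewrite (submx_trans (submxMl _ _)) //.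
  by rewrite (submx_trans (submxMr _ PX)).
(* Left multiplications keep [X] stable, so every conjugate of [P] fixes it pointwise. *)
have uphi q (u : 'M_(q, _)) : (u <= X)%MS -> u *m phi = u.
  move=> uX; rewrite -scalemxAr mulmx_sumr (eq_bigr (fun=> u)) => [|h _].
    by rewrite sumr_const card_Sn -scaler_nat scalerA mulVf ?scale1r.
  rewrite !mulmxA uP; last by rewrite (submx_trans (submxMr _ uX)).
  by rewrite -mulmxA Lperm0M mulVg Lperm0_1 mulmx1.
have x0 : word 0 by apply: finfun => -[].
exists (ev (x0, 1%g) *m phi) => [|q u uX].
  exact: submx_trans (submxMl _ _) phiX.
(* By equivariance, right multiplication by phi(1) is [phi] itself. *)
rewrite -[RHS]uphi //; congr (_ *m _); apply: eq_ev => -[x rho].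
rewrite ev_Rsum /= mulmx1 -mulmxA -phiL mulmxA ev_Lperm0 mulg1.
by rewrite (word0_eq x0 x).
Qed.

(** Supplies the expression of [e] as a sum of g_i(w_i); the pseudo-inverse turns coefficients
    against [<<B s>>] into coefficients against [B s], which has the same row space. *)
Lemma dual_image_span d r (e : 'M[F]_(r, dimU 0)) :
  let B (s : Ix d) := dualchain N (wordvec s.1) d *m Lperm0 F m n s.2 in
  (e <= \sum_s <<B s>>)%MS ->
  exists u : Ix d -> 'M[F]_(r, dimU d), e = \sum_s u s *m B s.
Proof.
move=> B /sub_sumsmxP[v ->].
exists (fun s => v s *m <<B s>>%MS *m pinvmx (B s)); apply: eq_bigr => s _.
by rewrite mulmxKpV // (submx_trans (submxMl _ _)) // genmxE.
Qed.

Lemma commW_genA_Rsum d (T : 'M[F]_(dimU d)) : (d <= N)%N -> N`!%:R != 0 :> F ->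
  preserves T -> (forall ws sigma vs, commW T (genA d ws sigma vs)) ->
  exists c, eqR T (Rsum d c).
Proof.
move=> dN N0 pT TA.
have d0 : d`!%:R != 0 :> F.
  (* d! divides N!. *)
  apply: contraNneq N0 => d0.
  by rewrite -(bin_fact dN) mulnCA natrM d0 mul0r.
pose B (s : Ix d) := dualchain N (wordvec s.1) d *m Lperm0 F m n s.2.
pose X := (\sum_s <<B s>>)%MS.
have BX s : (B s <= X)%MS by rewrite (sumsmx_sup s) // genmxE.
have Xstab g : (X *m Lperm0 F m n g <= X)%MS.
  rewrite sumsmxMr; apply/sumsmx_subP => -[y sigma] _.
  rewrite (eqmxMr _ (genmxE _)) -mulmxA Lperm0M.
  exact: (BX (y, (g * sigma)%g)).
have [e eX Xe] := left_ideal_right_identity N0 Xstab.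
have [u def_e] := dual_image_span eX.
(* The element sum_i g_i(T w_i) of G. *)
exists (\sum_s u s *m T *m B s).
(* d! w e is the sum of the up_y(dual_y(w) e), and dual_y(w) lies in I, where [e] is a right
   identity. *)
have e1 : eqR (Rsum d e) 1%:M.
  rewrite -[Rsum d e](scalerK d0) -[X in eqR _ X](scalerK d0); apply: eqRZ.
  rewrite -[X in eqR X]mul_scalar_mx [X in eqR _ X]scalemx1.
  apply: eqR_trans (eqRMr (Rel_Rsum _ _) (eqR_sym (eqR_dual_up dN))) _.
  rewrite mulmx_suml; apply: eqR_trans (eqR_dual_up dN).
  apply: eqR_sum => y _; rewrite -mulmxA -Rsum_upchain mulmxA Xe; first exact: eqR_refl.
  by have := BX (y, 1%g); rewrite /B Lperm0_1 mulmx1.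
apply: (@eqR_trans _ _ (Rsum d e *m T)).
  by rewrite -[X in eqR X]mul1mx; apply: eqRMr pT (eqR_sym e1).
(* At [x] tensor [rho], take f to be L(rho) followed by up_x: then f g_s is the generator with
   permutation [rho * s.2], which commutes with [T]. *)
apply: eqR_ev => -[x rho]; rewrite mulmxA !ev_Rsum def_e !mulmx_suml.
apply: eqR_sum => s _; have := TA (wordvec x) (rho * s.2)%g (wordvec s.1).
rewrite /genA -Lperm0M => /(eqRMl (u s)) /eqR_sym.
by rewrite !mulmxA.
Qed.

Lemma commW_Rperm_sum d (c : {ffun {perm 'I_N} -> F}) (A B : 'M[F]_(dimU d)) :
  preserves B -> (forall tau, commW B (Rperm F m n d tau)) ->
  eqR A (\sum_tau c tau *: Rperm F m n d tau) -> commW A B.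
Proof.
move=> pB BR; set S := \sum_tau _ => AS.
apply: eqR_trans (eqRMr pB AS) _; apply: eqR_trans (eqRMl _ (eqR_sym AS)).
rewrite mulmx_suml mulmx_sumr; apply: eqR_sum => tau _.
rewrite -scalemxAl -scalemxAr; apply: eqRZ; exact: eqR_sym (BR tau).
Qed.

End Modules.

Theorem theorem4p1 (R : realType) (m n d k : nat) :
  (1 <= m)%N -> (1 <= n)%N -> (1 <= d)%N -> (k <= d)%N ->
  let F := R[i] in
  let N := (d + k)%N in
  (* the generators and the right action of S_{d+k} are operators on W *)
  (forall ws (sigma : {perm 'I_N}) vs, preserves (@genA F m n N d ws sigma vs)) /\
  (forall pi : {perm 'I_N}, preserves (Rperm F m n d pi)) /\
  (* A_d^k = End_{C S_{d+k}}(W) *)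
  (forall A : 'M[F]_(dimU m n N d), preserves A ->
     (inAlg A <-> forall pi : {perm 'I_N}, commW A (Rperm F m n d pi))) /\
  (* End_{A_d^k}(W) = C S_{d+k} *)
  (forall A : 'M[F]_(dimU m n N d), preserves A ->
     ((forall B : 'M[F]_(dimU m n N d), preserves B -> inAlg B -> commW A B) <->
      exists c : {ffun {perm 'I_N} -> F},
        (A - \sum_(pi : {perm 'I_N}) c pi *: Rperm F m n d pi <= Rel F m n N d)%MS)).
Proof.
move=> _ _ _ _ F N.
have dN : (d <= N)%N by apply: leq_addr.
(* Characteristic 0 makes both d! and N! invertible. *)
have fact0 r : r`!%:R != 0 :> F by rewrite Num.Theory.pnatr_eq0 -lt0n fact_gt0.
split; first by move=> ws sigma vs; apply: preserves_genA.
split; first by move=> tau; apply: Rel_Rperm.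
split=> A pA.
  by split=> [AA tau|]; [apply: inAlg_commW | apply: commW_inAlg].
split=> [AC|[c Ac] B pB BA].
  have [|c Ac] := @commW_genA_Rsum F m n N d A dN (fact0 N) pA.
    by move=> ws sigma vs; apply: AC; [apply: preserves_genA | apply: inAlg_genA].
  (* The empty word: coefficients in G are read at the basis elements [(x0, tau)]. *)
  have x0 : word m n 0 by apply: finfun => -[].
  exists [ffun tau => c 0 (enum_rank (x0, tau))].
  under eq_bigr do rewrite ffunE.
  by rewrite -Rsum_perm.
by apply: commW_Rperm_sum pB _ Ac => tau; apply: inAlg_commW.
Qed.
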